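(* For every integer $n\ge 1$, the number $S_n(2431,4231,1432,4132)$ of permutations of length $n$ that avoid all four of the patterns $2431$, $4231$, $1432$ and $4132$ satisfies \[ S_n(2431,4231,1432,4132)=\binom{2(n-1)}{n-1}=b_{n-1}, \] where $b_m=\binom{2m}{m}$ denotes the $m$-th central binomial coefficient.
   Context: A permutation of length $n$ is a bijection of $[n]=\{1,\dots,n\}$, written in one-line notation $\tau=\tau(1)\tau(2)\cdots\tau(n)$. A permutation $\tau$ of length $n$ contains a permutation $\pi$ of length $k\le n$ as a pattern if there are indices $i_1<i_2<\dots<i_k$ such that the subsequence $\tau(i_1)\tau(i_2)\cdots\tau(i_k)$ is order-isomorphic to $\pi$, i.e. $\tau(i_a)<\tau(i_b)$ if and only if $\pi(a)<\pi(b)$ for all $a,b\in[k]$. Otherwise (in particular if $k>n$) $\tau$ avoids $\pi$. For a finite set $\Pi$ of permutations, $S_n(\Pi)$ denotes the number of permutations of length $n$ that avoid every pattern in $\Pi$. *)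

(* Defs.v *)
From mathcomp Require Import all_boot all_fingroup.

Set Implicit Arguments.
Unset Strict Implicit.
Unset Printing Implicit Defensive.

(* A permutation of length n is an element of 'S_n, acting on {0, ..., n-1}
   rather than on {1, ..., n}; this shift is irrelevant for order isomorphism. *)

(* f picks the positions i_1 < ... < i_k of an occurrence of pi in tau. *)
Definition contains (n k : nat) (tau : 'S_n) (pi : 'S_k) : bool :=
  [exists f : {ffun 'I_k -> 'I_n},
    [forall a : 'I_k, forall b : 'I_k, (a < b) ==> (f a < f b)] &&
    [forall a : 'I_k, forall b : 'I_k,
       (tau (f a) < tau (f b)) == (pi a < pi b)]].

Definition avoids (n k : nat) (tau : 'S_n) (pi : 'S_k) : bool :=
  ~~ contains tau pi.

(* A permutation together with its length, so that a set of patterns may mix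
   lengths. *)
Definition pattern : Type := {k : nat & 'S_k}.

(* The finite set of patterns is given by a list of its elements. *)
Definition avoiders (n : nat) (Pi : seq pattern) : {set 'S_n} :=
  [set tau : 'S_n | all (fun p : pattern => avoids tau (tagged p)) Pi].

Definition num_avoiders (n : nat) (Pi : seq pattern) : nat :=
  #|avoiders n Pi|.

Section OneLine.

Variables (w : seq nat) (w_perm : perm_eq w (iota 1 (size w))).

Lemma oneline_range (i : 'I_(size w)) : 0 < nth 0 w i <= size w.
Proof.
have: nth 0 w i \in iota 1 (size w) by rewrite -(perm_mem w_perm) mem_nth.
by rewrite mem_iota add1n ltnS.
Qed.

Lemma oneline_bound (i : 'I_(size w)) : (nth 0 w i).-1 < size w.
Proof. by have /andP[w_gt0 w_le] := oneline_range i; rewrite prednK. Qed.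

Definition oneline_fun (i : 'I_(size w)) : 'I_(size w) :=
  Ordinal (oneline_bound i).

Lemma oneline_inj : injective oneline_fun.
Proof.
move=> i j /(congr1 val) /= eq_pred; apply/val_inj/eqP => /=.
have w_uniq : uniq w by rewrite (perm_uniq w_perm) iota_uniq.
have /andP[i_gt0 _] := oneline_range i; have /andP[j_gt0 _] := oneline_range j.
by rewrite -(nth_uniq 0 (ltn_ord i) (ltn_ord j) w_uniq)
           -(prednK i_gt0) -(prednK j_gt0) eq_pred.
Qed.

(* The permutation with one-line notation w, whose entries are 1, ..., size w. *)
Definition oneline : 'S_(size w) := perm oneline_inj.

Lemma onelineE (i : 'I_(size w)) : oneline i = (nth 0 w i).-1 :> nat.
Proof. by rewrite permE. Qed.

Definition oneline_pattern : pattern := Tagged (fun k => 'S_k) oneline.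

End OneLine.

Definition p2431 : pattern := @oneline_pattern [:: 2; 4; 3; 1] isT.
Definition p4231 : pattern := @oneline_pattern [:: 4; 2; 3; 1] isT.
Definition p1432 : pattern := @oneline_pattern [:: 1; 4; 3; 2] isT.
Definition p4132 : pattern := @oneline_pattern [:: 4; 1; 3; 2] isT.

Definition central_binomial (m : nat) : nat := 'C(2 * m, m).

(* Main.v *)
(* The patterns are exactly the length-4 permutations in which the entry in the
   third position has a larger and a smaller entry on its left and a smaller one
   on its right.  So the avoiders are the permutations each of whose entries is
   a left-to-right maximum, a left-to-right minimum or a right-to-left minimum.
   Let D(n, t) count those of length n in which every entry that is only a
   right-to-left minimum has value < t, values running from 0 to n-1.  Appending
   a last entry v (entries >= v being shifted up) keeps the other
   maxima and minima from the left, and of the minima from the right exactly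
   those below v, so D(n+1, t) = D(n, t) + sum_(v < t) D(n, v) for 0 < t <= n.
   This is solved by D(k+1, s+1) = sum_(s <= i <= k) C(k+s, i). *)
Require Import Defs.
From mathcomp Require Import all_boot all_fingroup zify.

Set Implicit Arguments.
Unset Strict Implicit.
Unset Printing Implicit Defensive.

(** * Entries extremal from the left or from the right *)

Definition lrmax n (s : 'S_n) (i : 'I_n) :=
  [forall j : 'I_n, (j < i) ==> (s j < s i)].
Definition lrmin n (s : 'S_n) (i : 'I_n) :=
  [forall j : 'I_n, (j < i) ==> (s i < s j)].
Definition rlmin n (s : 'S_n) (i : 'I_n) :=
  [forall j : 'I_n, (i < j) ==> (s i < s j)].

(** At [t = n] the bound holds for every value, which gives the avoiders; smaller [t] arise when a
    last entry is removed. *)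
Definition extremal_below n t (s : 'S_n) :=
  [forall i, [|| lrmax s i, lrmin s i | rlmin s i && (s i < t)]].

Definition num_extremal n t := #|[pred s : 'S_n | extremal_below t s]|.

Lemma perm_val_neq n (s : 'S_n) i j : i != j -> s i != s j :> nat.
Proof. by rewrite (inj_eq val_inj) (inj_eq perm_inj). Qed.

Lemma forall_implyPn n (P Q Q' : pred 'I_n) :
    (forall j, P j -> ~~ Q j = Q' j) ->
  reflect (exists2 j, P j & Q' j) (~~ [forall j, P j ==> Q j]).
Proof.
move=> negQ; apply: (iffP forallPn) => [[j]|[j Pj Q'j]].
  by rewrite negb_imply => /andP[Pj]; rewrite negQ //; exists j.
by exists j; rewrite Pj negQ.
Qed.

Lemma perm_geq n (s : 'S_n) i j : i != j -> ~~ (s i < s j) = (s j < s i).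
Proof. by move/(perm_val_neq s); case: ltngtP. Qed.

Lemma lrmaxPn n (s : 'S_n) (i : 'I_n) :
  reflect (exists2 j : 'I_n, j < i & s i < s j) (~~ lrmax s i).
Proof.
apply: forall_implyPn => j ji; apply: perm_geq.
by rewrite -(inj_eq val_inj) ltn_eqF.
Qed.

Lemma lrminPn n (s : 'S_n) (i : 'I_n) :
  reflect (exists2 j : 'I_n, j < i & s j < s i) (~~ lrmin s i).
Proof.
apply: forall_implyPn => j ji; apply: perm_geq.
by rewrite -(inj_eq val_inj) gtn_eqF.
Qed.

Lemma rlminPn n (s : 'S_n) (i : 'I_n) :
  reflect (exists2 j : 'I_n, i < j & s j < s i) (~~ rlmin s i).
Proof.
apply: forall_implyPn => j ij; apply: perm_geq.
by rewrite -(inj_eq val_inj) ltn_eqF.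
Qed.

(** * Avoidance as extremality of every entry *)

(** Positions are indexed by [nat] so that an occurrence can be given as an explicit list through
    [nth]. *)
Lemma contains_onelineP n (s : 'S_n) w (w_perm : perm_eq w (iota 1 (size w))) :
    0 < size w ->
  reflect (exists x : nat -> 'I_n,
      {in gtn (size w) &, forall a b, a < b -> x a < x b} /\
      {in gtn (size w) &,
        forall a b, (s (x a) < s (x b)) = (nth 0 w a < nth 0 w b)})
    (contains s (oneline w_perm)).
Proof.
move=> w_gt0; have predE (a b : 'I_(size w)) :
    (oneline w_perm a < oneline w_perm b) = (nth 0 w a < nth 0 w b).
  rewrite !onelineE.
  have /andP[a_gt0 _] := oneline_range w_perm a.
  have /andP[b_gt0 _] := oneline_range w_perm b.
  by rewrite -ltnS !prednK.
apply: (iffP existsP) =>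
    [[f /andP[/forallP incf /forallP isof]]|[x [incx isox]]].
  exists (fun a => f (insubd (Ordinal w_gt0) a)).
  split=> a b /[!inE] ltaw ltbw.
    move=> ltab; have /forallP := incf (insubd (Ordinal w_gt0) a).
    move/(_ (insubd (Ordinal w_gt0) b)).
    by rewrite !val_insubd ltaw ltbw ltab.
  have /forallP := isof (insubd (Ordinal w_gt0) a).
  move/(_ (insubd (Ordinal w_gt0) b))/eqP->.
  by rewrite predE !val_insubd ltaw ltbw.
exists [ffun a : 'I_(size w) => x a].
apply/andP; split; apply/forallP=> a; apply/forallP=> b; rewrite !ffunE.
  by apply/implyP/incx; apply: ltn_ord.
by rewrite predE isox //; apply: ltn_ord.
Qed.

Lemma extremal_belowPn n (s : 'S_n) :
  reflect (exists i j k l : 'I_n,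
     [/\ j < i, k < i & i < l] /\ [/\ s i < s j, s k < s i & s l < s i])
    (~~ extremal_below n s).
Proof.
apply: (iffP idP) => [/forallPn[i]|[i [j [k [l [[ji ki il] [sj sk sl]]]]]]].
  rewrite ltn_ord andbT !negb_or.
  case/and3P=> /lrmaxPn[j ji sj] /lrminPn[k ki sk] /rlminPn[l il sl].
  by exists i, j, k, l.
apply/forallPn; exists i; rewrite ltn_ord andbT !negb_or; apply/and3P; split.
- by apply/lrmaxPn; exists j.
- by apply/lrminPn; exists k.
- by apply/rlminPn; exists l.
Qed.

Lemma avoiders_extremal n :
  avoiders n [:: p2431; p4231; p1432; p4132] =
  [set s | extremal_below n s].
Proof.
apply/setP=> s; rewrite !inE /all andbT.
have c2431 := @contains_onelineP n s [:: 2; 4; 3; 1] isT isT.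
have c4231 := @contains_onelineP n s [:: 4; 2; 3; 1] isT isT.
have c1432 := @contains_onelineP n s [:: 1; 4; 3; 2] isT isT.
have c4132 := @contains_onelineP n s [:: 4; 1; 3; 2] isT isT.
apply/idP/idP; apply: contraTT; last first.
  rewrite !negb_and !negbK => H; apply/extremal_belowPn.
  by case/or4P: H => [/c2431|/c4231|/c1432|/c4132] [x [incx isox]];
   [ exists (x 2), (x 1), (x 0), (x 3) | exists (x 2), (x 0), (x 1), (x 3)
   | exists (x 2), (x 1), (x 0), (x 3) | exists (x 2), (x 0), (x 1), (x 3) ];
   split; split; rewrite ?incx ?isox.
case/extremal_belowPn=> [i [j [k [l [[ji ki il] [sj sk sl]]]]]].
rewrite !negb_and !negbK.
(* Entry [i] plays 3 and [j] plays 4; the order of the positions [j], [k] and of the values [s k],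
   [s l] selects one of the four patterns. *)
have: (j < k) || (k < j).
  by rewrite -neq_ltn; apply/eqP=> /val_inj ejk; move: sj sk; rewrite ejk; lia.
have: (s k < s l) || (s l < s k).
  rewrite -neq_ltn; apply: perm_val_neq.
  by apply/eqP => ekl; move: ki il; rewrite ekl; lia.
case/orP=> ?; case/orP=> ?;
  [ apply/or4P/Or44/c4132; exists (nth i [:: j; k; i; l])
  | apply/or4P/Or43/c1432; exists (nth i [:: k; j; i; l])
  | apply/or4P/Or42/c4231; exists (nth i [:: j; k; i; l])
  | apply/or4P/Or41/c2431; exists (nth i [:: k; j; i; l]) ];
  split=> [] [|[|[|[|a]]]] [|[|[|[|b]]]] /[!inE] //=; lia.
Qed.

(** * Appending a last entry *)

Lemma card_lift_perm n (P : pred 'S_n.+1) :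
  #|P| = \sum_(v < n.+1) #|[pred s : 'S_n | P (lift_perm ord_max v s)]|.
Proof.
pose F (p : 'I_n.+1 * 'S_n) := lift_perm ord_max p.1 p.2.
have F_inj : injective F.
  case=> [v s] [w r] eqF.
  have evw : v = w.
    by have := congr1 (fun t : 'S_n.+1 => t ord_max) eqF; rewrite !lift_perm_id.
  move: eqF; rewrite evw => eqF; congr (_, _); apply/permP=> i.
  have := congr1 (fun t : 'S_n.+1 => t (lift ord_max i)) eqF.
  by rewrite !lift_perm_lift => /lift_inj.
(* Injectivity suffices, since both sides have (n+1) n! = (n+1)! elements. *)
have F_bij : bijective F.
  by apply: inj_card_bij F_inj _; rewrite card_prod card_ord !card_Sn factS.
rewrite -sum1_card (reindex F) /=; last exact: onW_bij.
rewrite -(pair_big_dep predT (fun v s => F (v, s) \in P) (fun _ _ => 1)) /=.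
by apply: eq_bigr => v _; rewrite -sum1_card; apply: eq_bigl => s; rewrite inE.
Qed.

Lemma forall_lift_max n (P : pred 'I_n.+1) :
  [forall i, P i] = P ord_max && [forall i, P (lift ord_max i)].
Proof.
apply/forallP/andP => [allP|[Pmax /forallP Plift] i].
  by split=> //; apply/forallP => i.
by case: (unliftP ord_max i) => [j ->|->].
Qed.

Section LiftPerm.

Variables (n : nat) (v : 'I_n.+1) (s : 'S_n).
Let sv := lift_perm ord_max v s.

Lemma lift_perm_ltn i j :
  (sv (lift ord_max i) < sv (lift ord_max j)) = (s i < s j).
Proof. by rewrite !lift_perm_lift /= !ltnNge leq_bump2. Qed.

Lemma lrmax_lift i : lrmax sv (lift ord_max i) = lrmax s i.
Proof.
rewrite /lrmax forall_lift_max lift_max [_ < i]ltnNge (ltnW (ltn_ord i)).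
rewrite implyFb andTb.
by apply: eq_forallb => j; rewrite lift_perm_ltn !lift_max.
Qed.

Lemma lrmin_lift i : lrmin sv (lift ord_max i) = lrmin s i.
Proof.
rewrite /lrmin forall_lift_max lift_max [_ < i]ltnNge (ltnW (ltn_ord i)).
rewrite implyFb andTb.
by apply: eq_forallb => j; rewrite lift_perm_ltn !lift_max.
Qed.

Lemma rlmin_lift i : rlmin sv (lift ord_max i) = rlmin s i && (s i < v).
Proof.
rewrite /rlmin forall_lift_max lift_max ltn_ord implyTb lift_perm_id.
rewrite andbC; congr (_ && _); last by rewrite lift_perm_lift /= /bump; lia.
by apply: eq_forallb => j; rewrite lift_perm_ltn !lift_max.
Qed.

Lemma lrmax_lift_max : lrmax sv ord_max = (v == n :> nat).
Proof.
rewrite /lrmax forall_lift_max ltnn lift_perm_id implyFb andTb.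
apply/forallP/eqP => [all_lt|vn i]; last first.
  by have := ltn_ord (s i); rewrite lift_perm_lift /= /bump vn; lia.
apply/eqP; rewrite eqn_leq -ltnS ltn_ord /= leqNgt; apply/negP => ltvn.
(* The entry of [s] with value [v] is shifted to [v + 1], above the last one. *)
have := all_lt ((s^-1)%g (Ordinal ltvn)).
by rewrite lift_perm_lift permKV lift_max ltn_ord /= /bump leqnn; lia.
Qed.

Lemma lrmin_lift_max : lrmin sv ord_max = (v == 0 :> nat).
Proof.
rewrite /lrmin forall_lift_max ltnn lift_perm_id implyFb andTb.
apply/forallP/eqP => [all_lt|v0 i]; last first.
  by rewrite lift_perm_lift lift_max ltn_ord /= /bump v0.
apply/eqP; rewrite -leqn0 leqNgt; apply/negP => v_gt0.
have ltvn : v.-1 < n by have := ltn_ord v; lia.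
(* The entry of [s] with value [v - 1] is not shifted and stays below the last one. *)
have := all_lt ((s^-1)%g (Ordinal ltvn)).
by rewrite lift_perm_lift permKV lift_max ltn_ord /= /bump; lia.
Qed.

Lemma rlmin_lift_max : rlmin sv ord_max.
Proof. by apply/forallP => i; rewrite ltnNge -ltnS ltn_ord. Qed.

(** The last entry is always a right-to-left minimum. Earlier ones remain so only below [v], where
    values are not shifted, so the bounds [v] and [t] combine into their minimum. *)
Lemma extremal_below_lift t :
  extremal_below t sv =
  [|| v == n :> nat, v == 0 :> nat | v < t] && extremal_below (minn v t) s.
Proof.
rewrite /extremal_below forall_lift_max lrmax_lift_max lrmin_lift_max.
rewrite rlmin_lift_max lift_perm_id; congr (_ && _); apply: eq_forallb => i.
rewrite lrmax_lift lrmin_lift rlmin_lift -andbA leq_min.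
by congr [|| _, _ | _ && _]; rewrite lift_perm_lift /= /bump; lia.
Qed.

End LiftPerm.

(** * Recurrences for the counts *)

Lemma num_extremalS n t :
  num_extremal n.+1 t =
  \sum_(v < n.+1 | [|| v == n :> nat, v == 0 :> nat | v < t])
    num_extremal n (minn v t).
Proof.
rewrite /num_extremal card_lift_perm [RHS]big_mkcond /=.
apply: eq_bigr => v _; case: ifPn => [vt|/negbTE vt].
  by apply: eq_card => s; rewrite !inE extremal_below_lift vt.
by apply: eq_card0 => s; rewrite !inE extremal_below_lift vt.
Qed.

(** The value 0 is always a left-to-right minimum. *)
Lemma num_extremal0 n : num_extremal n 0 = num_extremal n 1.
Proof.
apply: eq_card => s; rewrite !inE; apply: eq_forallb => i.
rewrite ltn0 andbF orbF ltnS leqn0.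
case: eqP => [si0|]; last by rewrite andbF orbF.
suff -> : lrmin s i by rewrite orbT.
apply/forallP => j; apply/implyP => ji; rewrite si0 lt0n -si0.
by apply: perm_val_neq; rewrite -(inj_eq val_inj) ltn_eqF.
Qed.

Lemma num_extremal_rec n t : 0 < t <= n ->
  num_extremal n.+1 t =
  num_extremal n t + \sum_(v < t) num_extremal n v.
Proof.
(* The term [v = n] yields [num_extremal n t]; the case [v = 0] already falls under [v < t]. *)
case/andP=> t_gt0 tn; rewrite num_extremalS big_mkcond big_ord_recr /= eqxx.
rewrite addnC (minn_idPr tn); congr (_ + _).
rewrite (big_ord_widen n (num_extremal n) tn) [RHS]big_mkcond /=.
apply: eq_bigr => v _; have -> : (v == n :> nat) = false by rewrite ltn_eqF.
case: eqP => [->|_] /=; first by rewrite t_gt0 min0n.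
by case: ifP => // /ltnW /minn_idPl ->.
Qed.

(** Difference of the recurrences at [t + 1] and [t]. *)
Lemma num_extremal_step n t : 0 < t < n ->
  num_extremal n.+1 t.+1 = num_extremal n.+1 t + num_extremal n t.+1.
Proof.
case/andP=> t_gt0 tn; rewrite !num_extremal_rec ?t_gt0 ?tn ?(ltnW tn) //.
by rewrite big_ord_recr /=; lia.
Qed.

(** The largest value [n] is always a left-to-right maximum. *)
Lemma num_extremal_full n : num_extremal n.+1 n.+1 = num_extremal n.+1 n.
Proof.
apply: eq_card => s; rewrite !inE; apply: eq_forallb => i.
rewrite ltnS leq_eqVlt; case: eqP => [sin|//].
suff -> : lrmax s i by [].
apply/forallP => j; apply/implyP => ji.
have : j != i by rewrite -(inj_eq val_inj) ltn_eqF.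
by move/(perm_val_neq s); have := ltn_ord (s j); rewrite sin; lia.
Qed.

(** * Solution by partial sums of binomial coefficients *)

Definition binom_tail k s := \sum_(s <= i < k.+1) 'C(k + s, i).

Lemma binom_tail0 k : binom_tail k 0 = 2 ^ k.
Proof.
rewrite /binom_tail addn0 big_mkord -[2]/(1 + 1) expnDn.
by apply: eq_bigr => i _; rewrite !exp1n !muln1.
Qed.

Lemma binom_tail_step k s : s <= k ->
  binom_tail k.+1 s.+1 = binom_tail k.+1 s + binom_tail k s.+1.
Proof.
move=> sk; rewrite /binom_tail !addSn !addnS big_add1 /=.
(* Pascal's rule gives two sums over row k+s+1, for i in s+1..k+1 and in s..k; moving the term i =
   k+1 to the second produces the two tails. *)
under eq_bigr do rewrite binS.
rewrite big_split /= addnC [in RHS]big_nat_recr 1?leqW //= -addnA.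
congr (_ + _).
rewrite -(big_add1 _ _ s k.+2 predT (fun i => 'C((k + s).+1, i))).
by rewrite big_nat_recr //= addnC.
Qed.

Lemma num_extremal_closed k s :
  s <= k -> num_extremal k.+1 s.+1 = binom_tail k s.
Proof.
elim: k s => [|k IHk] s.
  rewrite leqn0 => /eqP->; rewrite binom_tail0 /num_extremal.
  rewrite (eq_card (B := predT)) ?card_Sn // => t; rewrite !inE.
  apply/forallP => i; suff -> : lrmax t i by [].
  by apply/forallP => j; rewrite !ord1.
elim: s => [_|s IHs sk].
  rewrite num_extremal_rec // big_ord1 num_extremal0 IHk // !binom_tail0.
  by rewrite expnS; lia.
rewrite binom_tail_step // -IHs; last exact: ltnW.
have [ltsk|] := ltnP s k; first by rewrite num_extremal_step // IHk.
(* Here [s = k]: the tail [binom_tail k k.+1] is empty, matching [num_extremal_full]. *)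
rewrite leq_eqVlt ltnNge -ltnS sk orbF => /eqP <-.
by rewrite num_extremal_full /binom_tail big_geq ?addn0.
Qed.

Theorem theorem1 (n : nat) (hn : 1 <= n) :
  num_avoiders n [:: p2431; p4231; p1432; p4132] = 'C(2 * (n - 1), n - 1) /\
  'C(2 * (n - 1), n - 1) = central_binomial (n - 1).
Proof.
split=> //; rewrite /num_avoiders avoiders_extremal cardsE.
case: n hn => // k _; rewrite subn1 /= mul2n -addnn.
rewrite -[LHS]/(num_extremal k.+1 k.+1) num_extremal_closed //.
(* For [s = k] the only term is i = k. *)
by rewrite /binom_tail big_nat1.
Qed.
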